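(* Let $t<n/3$. The following protocol GC on $n$ processors, where $p_i$ has input bit $x_i$, solves binary Commit-Adopt against a mobile Byzantine $t$-MAd adversary. (1) Run the one-round protocol WC: each $p_i$ sends $x_i$ to every $p_j$; $p_j$ lets $Q_j^0$, $Q_j^1$ be the sets of processors from which it received $0$, resp. $1$, and sets $y_j:=0$ if $|Q_j^0|>2n/3$, else $y_j:=1$ if $|Q_j^1|>2n/3$, else $y_j:=\bot$. (2) Each $p_i$ sends $y_i$ to every $p_j$; $p_j$ lets $P_j^0$, $P_j^1$ be the sets of processors from which it received $0$, resp. $1$. (3) Each $p_j$ sets $b_j:=0$ if $|P_j^0|\ge|P_j^1|$ and $b_j:=1$ otherwise. (4) Each $p_j$ outputs $commit(b_j)$ if $|P_j^{b_j}|>2n/3$ and $adopt(b_j)$ otherwise.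
   Context: System: $n$ processors run a synchronous round-based protocol; each round every processor sends a (possibly different) message to every processor over dedicated point-to-point channels whose receiver knows the sender identity; messages of round $\rho$ are delivered by the start of round $\rho+1$. A message adversary (MAd) sees all messages; in the Byzantine type it may delete or arbitrarily replace any outgoing message, in a given round, of the processors it corrupts in that round; it never alters internal states, inputs, outputs or incoming messages. A mobile $t$-MAd adversary corrupts at most $t$ processors in each round, possibly a different set each round. Every processor (corrupted or not) must output and the task conditions apply to all processors. Binary Commit-Adopt: each processor has an input bit and outputs $commit(v)$ or $adopt(v)$ for a bit $v$; if all inputs equal $v$ all output $commit(v)$; if some processor outputs $commit(v)$ then every processor outputs $commit(v)$ or $adopt(v)$. *)

(* Defs.v *)
From mathcomp Require Import all_boot.

Set Implicit Arguments.
Unset Strict Implicit.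
Unset Printing Implicit Defensive.

(* Synchronous message-passing protocols for the processors 'I_n, with message
   alphabet M, outputs in O, and local states in S before the first remaining
   round.  Every processor sends a message on each of its n channels (the one
   to itself included); [None] in an inbox means that nothing was delivered on
   that channel.  The type of local states may change from round to round. *)
Inductive protocol (n : nat) (M O S : Type) : Type :=
| Output (out : 'I_n -> S -> O)
| Round (S' : Type)
    (send : 'I_n -> S -> 'I_n -> M)
    (recv : 'I_n -> S -> ('I_n -> option M) -> S')
    (next : protocol n M O S').

Arguments Output {n M O S} out.
Arguments Round {n M O S S'} send recv next.

(* Run [p]; then run [q], the outputs of [p] being the inputs of [q].  Steps
   that are merely local computation take no round: the output of [p] is
   folded into the first step of [q]. *)
Definition pre_compose (n : nat) (M O S T : Type) (out : 'I_n -> S -> T)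
    (q : protocol n M O T) : protocol n M O S :=
  match q with
  | Output out' => Output (fun i s => out' i (out i s))
  | Round _ send recv next =>
      Round (fun i s => send i (out i s)) (fun i s => recv i (out i s)) next
  end.

Fixpoint compose (n : nat) (M O S T : Type) (p : protocol n M T S)
    (q : protocol n M O T) : protocol n M O S :=
  match p with
  | Output out => pre_compose out q
  | Round _ send recv next => Round send recv (compose next q)
  end.

(* [m i j] is the message sent by i to j in a given round. *)
Definition traffic (n : nat) (M : Type) : Type := 'I_n -> 'I_n -> M.

(* The adversary sees all the messages sent so far, those of the current round
   included: a history lists the traffic of all rounds, current round first.
   [tamper h i j] only matters when i is corrupted. *)
Record byz_adversary (n : nat) (M : Type) : Type := ByzAdversary {
  corrupted : seq (traffic n M) -> {set 'I_n};
  tamper : seq (traffic n M) -> 'I_n -> 'I_n -> option M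
}.

Definition mobile (n : nat) (M : Type) (t : nat) (A : byz_adversary n M) : Prop :=
  forall h : seq (traffic n M), #|corrupted A h| <= t.

Definition delivered (n : nat) (M : Type) (A : byz_adversary n M)
    (h : seq (traffic n M)) (m : traffic n M) (i j : 'I_n) : option M :=
  if i \in corrupted A (m :: h) then tamper A (m :: h) i j else Some (m i j).

Fixpoint run_from (n : nat) (M O S : Type) (A : byz_adversary n M)
    (h : seq (traffic n M)) (p : protocol n M O S) (s : 'I_n -> S) : 'I_n -> O :=
  match p with
  | Output out => fun i => out i (s i)
  | Round _ send recv next =>
      let m := fun i j => send i (s i) j in
      run_from A (m :: h) next
        (fun j => recv j (s j) (fun i => delivered A h m i j))
  end.

Definition run (n : nat) (M O I : Type) (A : byz_adversary n M)
    (p : protocol n M O I) (x : 'I_n -> I) : 'I_n -> O :=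
  run_from A [::] p x.

(* The task is a relation between the inputs and the outputs of all processors,
   whether or not they have been corrupted in some round. *)
Definition solves_against_mobile_byz (n t : nat) (M O I : Type)
    (p : protocol n M O I)
    (task : ('I_n -> I) -> ('I_n -> O) -> Prop) : Prop :=
  forall A : byz_adversary n M, mobile t A ->
  forall x : 'I_n -> I, task x (run A p x).

Inductive ca_output : Type := Commit of bool | Adopt of bool.

Definition commit_adopt (n : nat) (x : 'I_n -> bool) (o : 'I_n -> ca_output) : Prop :=
  (forall v : bool, (forall i, x i = v) -> forall i, o i = Commit v) /\
  (forall v : bool, (exists i, o i = Commit v) ->
     forall j, o j = Commit v \/ o j = Adopt v).

(* Messages are bits or bot, encoded in [option bool] with bits 0 = [false] and
   1 = [true].  Anything else a corrupted channel could carry would be ignored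
   by the receiver, exactly as bot is. *)
Definition senders_of (n : nat) (inbox : 'I_n -> option (option bool)) (v : bool) :
    {set 'I_n} :=
  [set i | inbox i == Some (Some v)].

(* |X| > 2n/3 *)
Definition more_than_two_thirds (n : nat) (X : {set 'I_n}) : bool :=
  2 * n < 3 * #|X|.

Definition WC_decide (n : nat) (inbox : 'I_n -> option (option bool)) : option bool :=
  let Q := senders_of inbox in
  if more_than_two_thirds (Q false) then Some false
  else if more_than_two_thirds (Q true) then Some true
  else None.

Definition WC (n : nat) : protocol n (option bool) (option bool) bool :=
  Round (fun _ x _ => Some x) (fun _ _ inbox => WC_decide inbox)
    (Output (fun _ y => y)).

Definition GC_decide (n : nat) (inbox : 'I_n -> option (option bool)) : ca_output :=
  let P := senders_of inbox in
  let b := if #|P false| >= #|P true| then false else true in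
  if more_than_two_thirds (P b) then Commit b else Adopt b.

Definition GC (n : nat) : protocol n (option bool) ca_output bool :=
  compose (WC n)
    (Round (fun _ y _ => y) (fun _ _ inbox => GC_decide inbox)
      (Output (fun _ o => o))).

(* Main.v *)
Require Import Defs.
From mathcomp Require Import all_boot zify.

Set Implicit Arguments.
Unset Strict Implicit.
Unset Printing Implicit Defensive.

(** In each round an inbox disagrees with the broadcast values on at most [t]
  channels. Two sets of more than 2n/3 senders share more than n/3 > t
  processors, hence an uncorrupted one: so WC never produces both the bit 0 and
  the bit 1. After that, a set of more than 2n/3 senders of [v] contains more
  than n/3 uncorrupted ones, which every processor hears, whereas at most [t]
  senders of the opposite bit are heard, all of them corrupted. *)

(** Both rounds are broadcasts, so [m] takes no receiver. Channels from [C] stay unconstrained and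
    may differ between two inboxes. *)
Definition faithful_outside n (C : {set 'I_n}) (m : 'I_n -> option bool)
    (inbox : 'I_n -> option (option bool)) : Prop :=
  forall i, i \notin C -> inbox i = Some (m i).

(** The corrupted set depends on the history but not on [j], so all inboxes of one round share the
    same [C]. *)
Lemma delivered_faithful n (A : byz_adversary n (option bool)) h
    (m : 'I_n -> option bool) j :
  faithful_outside (corrupted A ((fun i _ => m i) :: h)) m
    (fun i => delivered A h (fun i _ => m i) i j).
Proof. by move=> i /negbTE iC; rewrite /delivered iC. Qed.

Section FaithfulInboxes.

Variables (n t : nat) (C : {set 'I_n}) (m : 'I_n -> option bool).
Hypotheses (ht : 3 * t < n) (hC : #|C| <= t).

Implicit Type inbox : 'I_n -> option (option bool).

(** A bit that nobody sent can only arrive on channels from [C]. *)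
Lemma card_senders_absent inbox v :
  faithful_outside C m inbox -> (forall i, m i <> Some v) ->
  #|senders_of inbox v| <= t.
Proof.
move=> F mNv; apply: leq_trans (subset_leq_card _) hC.
apply/subsetP => i; rewrite inE; apply: contraLR => /F ->.
by apply/eqP => -[/mNv].
Qed.

Lemma senders_unanimous inbox v :
  faithful_outside C m inbox -> (forall i, m i = Some v) ->
  more_than_two_thirds (senders_of inbox v).
Proof.
move=> F mv; rewrite /more_than_two_thirds.
have : ~: C \subset senders_of inbox v.
  by apply/subsetP => i; rewrite !inE => /F ->; rewrite mv.
move/subset_leq_card; have := cardsC C; rewrite card_ord; lia.
Qed.

Lemma senders_witness inbox v :
  faithful_outside C m inbox -> more_than_two_thirds (senders_of inbox v) ->
  exists i, m i = Some v.
Proof.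
rewrite /more_than_two_thirds => F big.
have /existsP[i /eqP] : [exists i, m i == Some v]; last by exists i.
apply: contraLR big => /existsPn mNv.
have := @card_senders_absent inbox v F (fun i => elimN eqP (mNv i)); lia.
Qed.

Lemma two_thirds_agree inbox inbox' v v' :
  faithful_outside C m inbox -> faithful_outside C m inbox' ->
  more_than_two_thirds (senders_of inbox v) ->
  more_than_two_thirds (senders_of inbox' v') -> v = v'.
Proof.
rewrite /more_than_two_thirds => F F' big big'.
have /subsetPn[i] : ~~ (senders_of inbox v :&: senders_of inbox' v' \subset C).
  apply/negP => /subset_leq_card.
  have := cardsUI (senders_of inbox v) (senders_of inbox' v').
  have := max_card (senders_of inbox v :|: senders_of inbox' v').
  rewrite card_ord; lia.
rewrite !inE => /andP[/eqP iv /eqP iv'] iC.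
by move: iv iv'; rewrite (F _ iC) (F' _ iC) => -[->] [].
Qed.

Lemma card_senders_heard inbox inbox' v :
  faithful_outside C m inbox -> faithful_outside C m inbox' ->
  #|senders_of inbox v| <= #|senders_of inbox' v| + t.
Proof.
clear ht; move=> F F'.
have /subset_leq_card : senders_of inbox v \subset senders_of inbox' v :|: C.
  apply/subsetP => i; rewrite !inE.
  by case: (boolP (i \in C)) => [|iC]; rewrite ?orbT // (F _ iC) (F' _ iC) orbF.
have := cardsUI (senders_of inbox' v) C; lia.
Qed.

End FaithfulInboxes.

Lemma WC_decide_bit n (inbox : 'I_n -> option (option bool)) v :
  WC_decide inbox = Some v -> more_than_two_thirds (senders_of inbox v).
Proof.
by rewrite /WC_decide; case: ifP => [big [<-] //|_]; case: ifP => // big [<-].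
Qed.

Lemma GC_decide_commit n (inbox : 'I_n -> option (option bool)) v :
  GC_decide inbox = Commit v -> more_than_two_thirds (senders_of inbox v).
Proof. by rewrite /GC_decide; case: leqP => _; case: ifP => // big [<-]. Qed.

(** Strictness excludes ties, which [GC_decide] resolves towards [false], so both bits can be
    treated alike. *)
Lemma GC_decide_majority n (inbox : 'I_n -> option (option bool)) v :
  #|senders_of inbox (~~ v)| < #|senders_of inbox v| ->
  GC_decide inbox =
    if more_than_two_thirds (senders_of inbox v) then Commit v else Adopt v.
Proof.
rewrite /GC_decide; case: v => /= lt_card; first by rewrite leqNgt lt_card.
by rewrite ltnW.
Qed.

Lemma WC_decide_unanimous n t (C : {set 'I_n}) m inbox v :
  3 * t < n -> #|C| <= t -> faithful_outside C m inbox ->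
  (forall i, m i = Some v) -> WC_decide inbox = Some v.
Proof.
move=> ht hC F mv.
have big := senders_unanimous ht hC F mv.
rewrite /WC_decide; case: v mv big => mv big; rewrite big //.
(* Only [v = true] remains. The test for [false] comes first and is ruled out by comparing [inbox]
   with itself. *)
case: ifP => // big'.
by have := two_thirds_agree ht hC F F big big'.
Qed.

Lemma WC_decide_agree n t (C : {set 'I_n}) m inbox inbox' v v' :
  3 * t < n -> #|C| <= t ->
  faithful_outside C m inbox -> faithful_outside C m inbox' ->
  WC_decide inbox = Some v -> WC_decide inbox' = Some v' -> v = v'.
Proof.
move=> ht hC F F' /WC_decide_bit big /WC_decide_bit.
exact: (two_thirds_agree ht hC F F' big).
Qed.

Lemma GC_decide_unanimous n t (C : {set 'I_n}) m inbox v :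
  3 * t < n -> #|C| <= t -> faithful_outside C m inbox ->
  (forall i, m i = Some v) -> GC_decide inbox = Commit v.
Proof.
move=> ht hC F mv.
have big := senders_unanimous ht hC F mv.
rewrite (@GC_decide_majority _ _ v) ?big //.
have small : #|senders_of inbox (~~ v)| <= t.
  by apply: card_senders_absent hC _ _ F _ => i; rewrite mv; case: (v).
move: big; rewrite /more_than_two_thirds; lia.
Qed.

Lemma GC_decide_agree n t (C : {set 'I_n}) m inbox inbox' v :
  3 * t < n -> #|C| <= t ->
  faithful_outside C m inbox -> faithful_outside C m inbox' ->
  (forall i j w w', m i = Some w -> m j = Some w' -> w = w') ->
  GC_decide inbox = Commit v ->
  GC_decide inbox' = Commit v \/ GC_decide inbox' = Adopt v.
Proof.
move=> ht hC F F' m_agree /GC_decide_commit big.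
(* Some processor really sent [v], so by [m_agree] none sent [~~ v]. *)
have [i miv] := senders_witness ht hC F big.
have small : #|senders_of inbox' (~~ v)| <= t.
  apply: card_senders_absent hC _ _ F' _ => j /(m_agree _ _ _ _ miv).
  by case: (v).
rewrite (@GC_decide_majority _ _ v); first by case: ifP; [left|right].
(* In [inbox'] the bit [v] has more than 2n/3 - t > n/3 > t senders, against at most t for
   [~~ v]. *)
have := card_senders_heard hC v F F'.
move: big; rewrite /more_than_two_thirds; lia.
Qed.

Theorem theorem5p3 (n t : nat) (ht : 3 * t < n) :
  solves_against_mobile_byz t (GC n) (@commit_adopt n).
Proof.
move=> A mobA x; rewrite /run /GC /=.
set m1 : traffic n (option bool) := fun i _ => Some (x i).
(* [y] is the broadcast of the second round. The two rounds have separate corrupted sets, each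
   bounded by [mobA]. *)
pose y j := WC_decide (fun i => delivered A [::] m1 i j).
have F1 j := @delivered_faithful n A [::] (fun i => Some (x i)) j.
have F2 j := @delivered_faithful n A [:: m1] y j.
split=> [v xv j | v [i iv] j].
  apply: (GC_decide_unanimous ht (mobA _) (F2 j)) => i.
  by apply: (WC_decide_unanimous ht (mobA _) (F1 i)) => k; rewrite xv.
apply: (GC_decide_agree ht (mobA _) (F2 i) (F2 j) _ iv) => k l w w'.
exact: (WC_decide_agree ht (mobA _) (F1 k) (F1 l)).
Qed.
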